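(* Let $(M^{2n+1},\varphi,\xi,\eta,g)$ be a trans-para-Sasakian manifold of type $(\alpha,\beta)$ such that $\varphi(\mathrm{grad}\,\alpha)=-(2n-1)\,\mathrm{grad}\,\beta$. If $M$ is Weyl projectively flat, i.e. $P=0$, then $M$ is an Einstein manifold.
   Context: Let $n\ge 1$ and let $M$ be a smooth manifold of dimension $2n+1$. An almost paracontact metric structure $(\varphi,\xi,\eta,g)$ on $M$ consists of a $(1,1)$-tensor field $\varphi$, a vector field $\xi$, a 1-form $\eta$ and a pseudo-Riemannian metric $g$ with $\varphi\xi=0$, $\eta\circ\varphi=0$, $\eta(\xi)=1$, $\varphi^2=\mathrm{id}-\eta\otimes\xi$, $g(\varphi X,\varphi Y)=-g(X,Y)+\eta(X)\eta(Y)$, such that $\varphi$ induces an almost paracomplex structure on $\ker\eta$ (its $\pm1$-eigendistributions there have equal rank $n$). Then $\eta(X)=g(X,\xi)$ and $g$ has signature $(n+1,n)$. Let $\nabla$ be the Levi-Civita connection of $g$. The manifold is called trans-para-Sasakian of type $(\alpha,\beta)$, where $\alpha,\beta$ are smooth functions on $M$, if for all vector fields $X,Y$ $$(\nabla_X\varphi)Y=\alpha(-g(X,Y)\xi+\eta(Y)X)+\beta(g(X,\varphi Y)\xi+\eta(Y)\varphi X).$$ Curvature: $R(X,Y)Z=\nabla_X\nabla_YZ-\nabla_Y\nabla_XZ-\nabla_{[X,Y]}Z$; $\mathrm{Ric}(Y,Z)$ is the trace of $X\mapsto R(X,Y)Z$; gradients are taken with respect to $g$. The Weyl projective curvature tensor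 is $P(X,Y)Z=R(X,Y)Z-\frac{1}{2n}\left(\mathrm{Ric}(Y,Z)X-\mathrm{Ric}(X,Z)Y\right)$. $M$ is Einstein if $\mathrm{Ric}=\lambda g$ for some function $\lambda$ (automatically locally constant since $\dim M\ge 3$). *)

(* Defs.v *)
From HB Require Import structures.
From mathcomp Require Import all_boot all_order all_algebra.
From mathcomp Require Import all_classical all_reals all_analysis.
Set Implicit Arguments.
Unset Strict Implicit.
Unset Printing Implicit Defensive.
Import Order.TTheory GRing.Theory Num.Theory numFieldNormedType.Exports.
Local Open Scope classical_set_scope.
Local Open Scope ring_scope.

(* C^oo on an open set A: every iterated directional derivative
   'D_v1 ('D_v2 (... f)) is Frechet-differentiable at every point of A. *)
Definition smooth_on (R : realType) (V W : normedModType R)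
    (A : set V) (f : V -> W) : Prop :=
  forall (vs : seq V) (x : V), A x ->
    differentiable (foldr (fun v (h : V -> W) => (fun y => 'D_v h y)) f vs) x.

(* [cmap] and [cinv] are total functions; only their values on [cdom] and on
   its image are meaningful. *)
Record chart (R : realType) (m : nat) (T : topologicalType) := Chart {
  cdom : set T;
  cmap : T -> 'rV[R]_m;
  cinv : 'rV[R]_m -> T;
  cdom_open : open cdom;
  cimg_open : open (cmap @` cdom);
  cmapK : forall p, cdom p -> cinv (cmap p) = p;
  cmap_cts : {within cdom, continuous cmap};
  cinv_cts : {within cmap @` cdom, continuous cinv} }.

Record manifold (R : realType) (m : nat) := Manifold {
  carrier :> topologicalType;
  manifold_hausdorff : hausdorff_space carrier;
  manifold_second_countable : @second_countable carrier;
  atlas : set (chart R m carrier);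
  atlas_cover : forall p : carrier, exists2 c, atlas c & cdom c p;
  atlas_compat : forall c d, atlas c -> atlas d ->
    smooth_on (cmap c @` (cdom c `&` cdom d)) (cmap d \o cinv c) }.

Section Calculus.
Variables (R : realType) (m : nat) (M : manifold R m).

Definition chart_at (p : M) : chart R m M := s2val (cid2 (atlas_cover p)).

Definition smooth_fun (U : set M) (f : M -> R) : Prop :=
  forall c, atlas c ->
    smooth_on (cmap c @` (U `&` cdom c)) ((f \o cinv c) : 'rV[R]_m -> R^o).

(* The tangent space T_p M is modelled on 'rV_m: the row vector v stands for
   the tangent vector \sum_i v_i d/dx^i at p, where x^1, ..., x^m are the
   coordinates of the chart [chart_at p].  No regularity of
   p |-> [chart_at p] is assumed, so smoothness of a vector field is not
   smoothness of its components; see [smooth_field]. *)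
Definition field := M -> 'rV[R]_m.

(* the derivative v(f) of f along the tangent vector v at p *)
Definition dir_deriv (f : M -> R) (p : M) (v : 'rV[R]_m) : R :=
  'D_v ((f \o cinv (chart_at p)) : 'rV[R]_m -> R^o) (cmap (chart_at p) p).

Definition act (X : field) (f : M -> R) : M -> R :=
  fun p => dir_deriv f p (X p).

Definition smooth_field (U : set M) (X : field) : Prop :=
  forall (V : set M) (f : M -> R), open V -> V `<=` U ->
    smooth_fun V f -> smooth_fun V (act X f).

(* [X, Y] is the field acting on functions by f |-> X(Yf) - Y(Xf); its k-th
   component at p is read off on the coordinate x^k of [chart_at p]. *)
Definition lie (X Y : field) : field := fun p =>
  \row_k (act X (act Y (fun q => cmap (chart_at p) q 0 k)) p
          - act Y (act X (fun q => cmap (chart_at p) q 0 k)) p).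

(* The field with constant components v in the coordinates [chart_at p],
   expressed at q in those of [chart_at q].  It is smooth on the domain of
   [chart_at p] and its value at p is v. *)
Definition extend (p : M) (v : 'rV[R]_m) : field := fun q =>
  'D_v (cmap (chart_at q) \o cinv (chart_at p)) (cmap (chart_at p) q).

(* A (0,2)-tensor is given by its Gram matrices: g(u, v) = u g v^T. *)
Definition form (g : M -> 'M[R]_m) (p : M) (u v : 'rV[R]_m) : R :=
  (u *m g p *m v^T) 0 0.

Definition pseudo_metric (g : M -> 'M[R]_m) : Prop :=
  [/\ forall p u v, form g p u v = form g p v u,
      forall p, g p \in unitmx
    & forall (U : set M) (X Y : field), open U ->
        smooth_field U X -> smooth_field U Y ->
        smooth_fun U (fun p => form g p (X p) (Y p))].

(* [nabla X Y] is the covariant derivative of Y along X.  The axioms are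
   imposed on fields that are smooth on an arbitrary open set U, i.e. on local
   vector fields; multiplying by the indicator function of U, which is smooth
   on U, shows that [nabla X Y] on U only depends on X and Y on U. *)
Record affine_connection (nabla : field -> field -> field) : Prop := {
  nabla_smooth : forall (U : set M) X Y, open U ->
    smooth_field U X -> smooth_field U Y -> smooth_field U (nabla X Y);
  nabla_addl : forall (U : set M) X X' Y p, open U -> U p ->
    smooth_field U X -> smooth_field U X' -> smooth_field U Y ->
    nabla (fun q => X q + X' q) Y p = nabla X Y p + nabla X' Y p;
  nabla_scalel : forall (U : set M) (f : M -> R) X Y p, open U -> U p ->
    smooth_fun U f -> smooth_field U X -> smooth_field U Y ->
    nabla (fun q => f q *: X q) Y p = f p *: nabla X Y p;
  nabla_addr : forall (U : set M) X Y Y' p, open U -> U p ->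
    smooth_field U X -> smooth_field U Y -> smooth_field U Y' ->
    nabla X (fun q => Y q + Y' q) p = nabla X Y p + nabla X Y' p;
  nabla_leibniz : forall (U : set M) (f : M -> R) X Y p, open U -> U p ->
    smooth_fun U f -> smooth_field U X -> smooth_field U Y ->
    nabla X (fun q => f q *: Y q) p = act X f p *: Y p + f p *: nabla X Y p }.

Definition torsion_free (nabla : field -> field -> field) : Prop :=
  forall (U : set M) X Y p, open U -> U p ->
    smooth_field U X -> smooth_field U Y ->
    nabla X Y p - nabla Y X p = lie X Y p.

Definition metric_compatible (g : M -> 'M[R]_m)
    (nabla : field -> field -> field) : Prop :=
  forall (U : set M) X Y Z p, open U -> U p ->
    smooth_field U X -> smooth_field U Y -> smooth_field U Z ->
    act X (fun q => form g q (Y q) (Z q)) p =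
    form g p (nabla X Y p) (Z p) + form g p (Y p) (nabla X Z p).

Definition levi_civita (g : M -> 'M[R]_m)
    (nabla : field -> field -> field) : Prop :=
  [/\ affine_connection nabla, torsion_free nabla & metric_compatible g nabla].

Definition Rm (nabla : field -> field -> field) (X Y Z : field) : field :=
  fun p => nabla X (nabla Y Z) p - nabla Y (nabla X Z) p
           - nabla (lie X Y) Z p.

(* Ric(Y, Z) at p is the trace of the endomorphism v |-> R(v, Y)Z of T_p M. *)
Definition Ric (nabla : field -> field -> field) (Y Z : field) : M -> R :=
  fun p => \tr (lin1_mx (fun v => Rm nabla (extend p v) Y Z p)).

(* g(grad f, v) = v(f) *)
Definition grad (g : M -> 'M[R]_m) (f : M -> R) : field := fun p =>
  (\row_i dir_deriv f p (delta_mx 0 i)) *m invmx (g p).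

Definition einstein (g : M -> 'M[R]_m)
    (nabla : field -> field -> field) : Prop :=
  exists lam : M -> R, forall (U : set M) X Y p, open U -> U p ->
    smooth_field U X -> smooth_field U Y ->
    Ric nabla X Y p = lam p * form g p (X p) (Y p).

End Calculus.

Section Paracontact.
Variables (R : realType) (n : nat) (M : manifold R n.*2.+1).

(* Tangent vectors are row vectors, so phi and eta act on the right:
   phi(u) = u phi and eta(u) = u eta. *)
Definition endo (phi : M -> 'M[R]_(n.*2.+1)) (p : M) (u : 'rV[R]_(n.*2.+1)) :
  'rV[R]_(n.*2.+1) := u *m phi p.

Definition oneform (eta : M -> 'cV[R]_(n.*2.+1)) (p : M)
  (u : 'rV[R]_(n.*2.+1)) : R := (u *m eta p) 0 0.

Record almost_paracontact_metric := AlmostParacontactMetric {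
  phi : M -> 'M[R]_(n.*2.+1);
  xi : field M;
  eta : M -> 'cV[R]_(n.*2.+1);
  metric : M -> 'M[R]_(n.*2.+1);
  phi_smooth : forall (U : set M) (X : field M), open U ->
    smooth_field U X -> smooth_field U (fun p => endo phi p (X p));
  xi_smooth : smooth_field setT xi;
  eta_smooth : forall (U : set M) (X : field M), open U ->
    smooth_field U X -> smooth_fun U (fun p => oneform eta p (X p));
  metric_pseudo : pseudo_metric metric;
  phi_xi : forall p, endo phi p (xi p) = 0;
  eta_phi : forall p u, oneform eta p (endo phi p u) = 0;
  eta_xi : forall p, oneform eta p (xi p) = 1;
  phi_phi : forall p u, endo phi p (endo phi p u) = u - oneform eta p u *: xi p;
  metric_phi : forall p u v,
    form metric p (endo phi p u) (endo phi p v) =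
    - form metric p u v + oneform eta p u * oneform eta p v;
  phi_eigen_pos :
    forall p, \rank (eigenspace (phi p) 1 :&: kermx (eta p))%MS = n;
  phi_eigen_neg :
    forall p, \rank (eigenspace (phi p) (- 1) :&: kermx (eta p))%MS = n }.

(* The left-hand side is (nabla_X phi) Y = nabla_X (phi Y) - phi (nabla_X Y). *)
Definition trans_para_sasakian (S : almost_paracontact_metric)
    (nabla : field M -> field M -> field M) (alpha beta : M -> R) : Prop :=
  forall (U : set M) (X Y : field M) (p : M), open U -> U p ->
    smooth_field U X -> smooth_field U Y ->
    nabla X (fun q => endo (phi S) q (Y q)) p - endo (phi S) p (nabla X Y p) =
    alpha p *: (- form (metric S) p (X p) (Y p) *: xi S p
                + oneform (eta S) p (Y p) *: X p)
    + beta p *: (form (metric S) p (X p) (endo (phi S) p (Y p)) *: xi S p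
                 + oneform (eta S) p (Y p) *: endo (phi S) p (X p)).

Definition weyl_projective (nabla : field M -> field M -> field M)
    (X Y Z : field M) : field M := fun p =>
  Rm nabla X Y Z p
  - (n.*2%:R)^-1 *: (Ric nabla Y Z p *: X p - Ric nabla X Z p *: Y p).

Definition weyl_projectively_flat
    (nabla : field M -> field M -> field M) : Prop :=
  forall (U : set M) (X Y Z : field M) (p : M), open U -> U p ->
    smooth_field U X -> smooth_field U Y -> smooth_field U Z ->
    weyl_projective nabla X Y Z p = 0.

End Paracontact.

(* Main.v *)
Require Import Defs.
From mathcomp Require Import all_boot all_order all_algebra.
From mathcomp Require Import all_classical all_reals all_analysis.
From mathcomp Require Import ring.
Import Order.TTheory GRing.Theory Num.Theory numFieldNormedType.Exports.
Local Open Scope classical_set_scope.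
Local Open Scope ring_scope.

Set Implicit Arguments.
Unset Strict Implicit.
Unset Printing Implicit Defensive.

(** Vanishing of the projective tensor means that the curvature is
      R(X, Y)Z = B(Y, Z) X - B(X, Z) Y   with   B = Ric / 2n.
    Compatibility of the connection with g makes the endomorphism R(X, Y)
    skew-adjoint ([Rm_skew]), so that
      B(Y, Z) g(X, W) - B(X, Z) g(Y, W) + B(Y, W) g(X, Z) - B(X, W) g(Y, Z) = 0.
    Over a space of dimension at least 2 this identity alone forces B to be a
    multiple of g ([skew_curvature_scalar]): taking W = Z and X with
    g(X, Z) = 1 gives B(Y, Z) = c(Z) g(Y, Z), and comparing two non-collinear
    vectors gives c(Z) = c(W).  So Ric is a multiple of g at every point
    ([projectively_flat_einstein]).

    The linear algebra is run on local fields instead of tangent vectors, so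
    that the tensoriality of Ric never has to be established: the identity above
    also shows that Ric(Y, Z) at p depends on the values Y(p) and Z(p) only.

    Skew-adjointness is the usual computation
      X(Y g(Z, W)) - Y(X g(Z, W)) - [X, Y] g(Z, W) = 0,
    which rests on the fact that the bracket, defined through the coordinate
    functions of one chart, is a smooth field and acts on all smooth functions
    as the commutator X Y - Y X ([lie_smooth], [act_lie]).  That in turn needs
    calculus in the charts: the chain rule, the stability of smooth maps under
    products and compositions ([smooth_onM], [smooth_on_comp]), and the symmetry
    of second derivatives ([derive_derive_comm]). *)

(** * Differentiation of germs *)

(** The differential of f also satisfies the first-order expansion of g, because
    the two remainders agree near the base point. *)
Lemma near_eq_differentiable (R : numFieldType) (V W : normedModType R)
    (f g : V -> W) (x : V) :
  {near x, f =1 g} -> differentiable f x -> differentiable g x.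
Proof.
move=> fg df.
have dg : g \o shift x = cst (g x) + 'd f x +o_ 0 id.
  apply/eqaddoP => e e0; have /eqaddoP/(_ e e0) H := diff_locally df.
  have fg0 : \forall h \near (0 : V), f (h + x) = g (h + x).
    by move: fg; rewrite [X in X -> _](near_shift 0) subr0.
  apply: filterS2 fg0 H => h fgh.
  by rewrite /= -[g x](nbhs_singleton fg) !fctE /= fgh.
apply/diff_locallyP; have dgE := diff_unique (diff_continuous df) dg.
by rewrite dgE; split; [exact: diff_continuous | exact: dg].
Qed.

Lemma open_near_eq (T : topologicalType) (U : Type) (A : set T) (f g : T -> U) x :
  open A -> A x -> (forall y, A y -> f y = g y) -> {near x, f =1 g}.
Proof.
by move=> oA Ax fg; apply: (filterS _ (open_nbhs_nbhs (conj oA Ax))) => y /fg.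
Qed.

(** * Smooth maps between normed spaces *)

Section Smooth.
Variables (R : realType).
Implicit Types V W : normedModType R.

(** Smoothness filtered by the number of derivatives: the product and chain rules
    express a derivative of order k through factors of order at most k, which
    calls for an induction on k with the functions generalized. *)
Fixpoint class_C V W (k : nat) (A : set V) (f : V -> W) : Prop :=
  (forall x, A x -> differentiable f x) /\
  if k is l.+1 then forall v, class_C l A (fun x => 'D_v f x) else True.

Lemma class_C_diff V W k (A : set V) (f : V -> W) x :
  class_C k A f -> A x -> differentiable f x.
Proof. by case: k => [|k] [] df _ /df. Qed.

Lemma smooth_onP V W (A : set V) (f : V -> W) :
  smooth_on A f <-> forall k, class_C k A f.
Proof.
split=> [sf k|cf vs].
  elim: k f sf => [|k IH] f sf; split=> //; try exact: (sf [::]).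
  move=> v; apply: IH => vs x Ax; have := sf (rcons vs v) x Ax.
  by rewrite foldr_rcons.
elim/last_ind: vs f cf => [|vs v IH] f cf x Ax; first exact: (class_C_diff (cf 0%N)).
by rewrite foldr_rcons; apply: IH => // k; exact: (cf k.+1).2.
Qed.

Lemma smooth_on_diff V W (A : set V) (f : V -> W) x :
  smooth_on A f -> A x -> differentiable f x.
Proof. by move=> sf; exact: (sf [::]). Qed.

Lemma smooth_on_derive V W (A : set V) (f : V -> W) v :
  smooth_on A f -> smooth_on A (fun x => 'D_v f x).
Proof. by move=> /smooth_onP cf; apply/smooth_onP => k; exact: (cf k.+1).2. Qed.

Lemma class_CW V W k (A : set V) (f : V -> W) : class_C k.+1 A f -> class_C k A f.
Proof. by elim: k f => [|k IH] f [df cf]; split=> //= v; exact/IH/cf. Qed.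

Lemma class_C_eq V W k (A : set V) (f g : V -> W) : open A ->
  (forall x, A x -> f x = g x) -> class_C k A f -> class_C k A g.
Proof.
move=> oA; elim: k f g => [|k IH] f g fg [df cf].
  split=> // x Ax; exact: near_eq_differentiable (open_near_eq oA Ax fg) (df x Ax).
split=> [x Ax|v].
  exact: near_eq_differentiable (open_near_eq oA Ax fg) (df x Ax).
by apply: IH (cf v) => x Ax; exact: near_eq_derive (open_near_eq oA Ax fg).
Qed.

Lemma class_CD V W k (A : set V) (f g : V -> W) : open A ->
  class_C k A f -> class_C k A g -> class_C k A (fun x => f x + g x).
Proof.
move=> oA; elim: k f g => [|k IH] f g [df cf] [dg cg].
  by split=> // x Ax; exact: differentiableD (df x Ax) (dg x Ax).
split=> [x Ax|v]; first exact: differentiableD (df x Ax) (dg x Ax).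
apply: class_C_eq (IH _ _ (cf v) (cg v)) => // x Ax.
by rewrite [RHS]deriveD //; apply: diff_derivable; [exact: df|exact: dg].
Qed.

Lemma class_C_cst V W k (A : set V) (a : W) : class_C k A (cst a).
Proof.
elim: k a => [|k IH] a; split=> // v.
have -> : (fun x : V => 'D_v (cst a) x) = cst 0 by apply/funext => x; exact: derive_cst.
exact: IH.
Qed.

Lemma class_CM V k (A : set V) (f g : V -> R^o) : open A ->
  class_C k A f -> class_C k A g -> class_C k A (fun x => f x * g x : R^o).
Proof.
move=> oA; elim: k f g => [|k IH] f g.
  by move=> [df _] [dg _]; split=> // x Ax; exact: differentiableM (df x Ax) (dg x Ax).
move=> Cf Cg; have [df cf] := Cf; have [dg cg] := Cg.
split=> [x Ax|v]; first exact: differentiableM (df x Ax) (dg x Ax).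
apply: class_C_eq
  (class_CD oA (IH _ _ (class_CW Cf) (cg v)) (IH _ _ (class_CW Cg) (cf v))) => // x Ax.
rewrite [RHS]deriveM //; apply: diff_derivable; [exact: df|exact: dg].
Qed.

Lemma class_C_sum V W (I : Type) (r : seq I) k (A : set V) (F : I -> V -> W) : open A ->
  (forall i, class_C k A (F i)) -> class_C k A (fun x => \sum_(i <- r) F i x).
Proof.
move=> oA cF; elim: r => [|i r IH].
  by apply: class_C_eq (class_C_cst k A 0) => // x _; rewrite big_nil.
by apply: class_C_eq (class_CD oA (cF i) IH) => // x _; rewrite big_cons.
Qed.

Lemma derive_mx_coord V m (t : V -> 'rV[R]_m) x v j : differentiable t x ->
  'D_v (fun y => t y 0 j : R^o) x = ('D_v t x) 0 j.
Proof. by move=> dt; rewrite (derive_mx (diff_derivable (v := v) dt)) mxE. Qed.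

Lemma differentiable_mx_coord V m (t : V -> 'rV[R]_m) x j : differentiable t x ->
  differentiable (fun y => t y 0 j : R^o) x.
Proof.
by move=> dt; apply: (@differentiable_comp _ _ _ _ t (fun N : 'rV[R]_m => N 0 j : R^o) x dt);
  exact: differentiable_coord.
Qed.

Lemma class_C_coord V m k (A : set V) (t : V -> 'rV[R]_m) j : open A ->
  class_C k A t -> class_C k A (fun x => t x 0 j : R^o).
Proof.
move=> oA; elim: k t => [|k IH] t [dt ct]; split=> //; try by move=> x /dt /(@differentiable_mx_coord _ _ _ _ j).
move=> v; apply: class_C_eq (IH _ (ct v)) => // x Ax.
by rewrite derive_mx_coord //; exact: dt.
Qed.

(** The differential of h is linear, so it is determined on the standard basis. *)
Lemma derive_coord_sum W m (h : 'rV[R]_m -> W) y w : differentiable h y ->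
  'D_w h y = \sum_j w 0 j *: 'D_(delta_mx 0 j) h y.
Proof.
move=> dh; rewrite deriveE // {1}(row_sum_delta w) linear_sum.
by apply: eq_bigr => j _; rewrite linearZ deriveE.
Qed.

Lemma derive_comp (U : normedModType R) V W (t : U -> V) (h : V -> W) x v :
  differentiable t x -> differentiable h (t x) ->
  'D_v (h \o t) x = 'D_('D_v t x) h (t x).
Proof.
move=> dt dh; have dht : differentiable (h \o t) x by exact: differentiable_comp.
by rewrite (deriveE _ dht) (deriveE _ dh) (deriveE _ dt) diff_comp.
Qed.

(** By the chain rule a directional derivative of h o t is a sum of products of
    derivatives of the components of t with partial derivatives of h composed
    with t, and the latter are of lower order. *)
Lemma class_C_comp V m k (A : set V) (B : set 'rV[R]_m)
    (t : V -> 'rV[R]_m) (h : 'rV[R]_m -> R^o) : open A ->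
  (forall x, A x -> B (t x)) -> class_C k A t -> class_C k B h ->
  class_C k A (h \o t).
Proof.
move=> oA AB; elim: k h => [|k IH] h.
  by move=> [dt _] [dh _]; split=> // x Ax; apply: differentiable_comp (dt x Ax) (dh _ (AB x Ax)).
move=> Ct [dh ch]; have [dt ct] := Ct; split=> [x Ax|v].
  by apply: differentiable_comp (dt x Ax) (dh _ (AB x Ax)).
apply: (@class_C_eq _ _ _ _ (fun x => \sum_j ('D_v t x) 0 j * 'D_(delta_mx 0 j) h (t x))) => //.
  move=> x Ax; have dhx := dh _ (AB x Ax).
  by rewrite (derive_comp v (dt x Ax) dhx) (derive_coord_sum _ dhx).
apply: class_C_sum => // j; apply: class_CM => //; first exact: (class_C_coord j oA (ct v)).
exact: (IH (fun y => 'D_(delta_mx 0 j) h y) (class_CW Ct) (ch _)).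
Qed.

Lemma smooth_on_sub V W (A B : set V) (f : V -> W) :
  B `<=` A -> smooth_on A f -> smooth_on B f.
Proof. by move=> BA sf vs x /BA; exact: sf. Qed.

Lemma smooth_on_eq V W (A : set V) (f g : V -> W) : open A ->
  (forall x, A x -> f x = g x) -> smooth_on A f -> smooth_on A g.
Proof. by move=> oA fg /smooth_onP sf; apply/smooth_onP => k; exact: class_C_eq fg (sf k). Qed.

Lemma smooth_onD V W (A : set V) (f g : V -> W) : open A ->
  smooth_on A f -> smooth_on A g -> smooth_on A (fun x => f x + g x).
Proof. by move=> oA /smooth_onP sf /smooth_onP sg; apply/smooth_onP => k; exact: class_CD. Qed.

Lemma smooth_on_cst V W (A : set V) (a : W) : smooth_on A (cst a).
Proof. by apply/smooth_onP => k; exact: class_C_cst. Qed.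

Lemma smooth_onM V (A : set V) (f g : V -> R^o) : open A ->
  smooth_on A f -> smooth_on A g -> smooth_on A (fun x => f x * g x : R^o).
Proof. by move=> oA /smooth_onP sf /smooth_onP sg; apply/smooth_onP => k; exact: class_CM. Qed.

Lemma smooth_on_coord V m (A : set V) (t : V -> 'rV[R]_m) j : open A ->
  smooth_on A t -> smooth_on A (fun x => t x 0 j : R^o).
Proof. by move=> oA /smooth_onP sf; apply/smooth_onP => k; exact: class_C_coord. Qed.

Lemma smooth_on_comp V m (A : set V) (B : set 'rV[R]_m)
    (t : V -> 'rV[R]_m) (h : 'rV[R]_m -> R^o) : open A ->
  (forall x, A x -> B (t x)) -> smooth_on A t -> smooth_on B h ->
  smooth_on A (h \o t).
Proof.
move=> oA AB /smooth_onP st /smooth_onP sh; apply/smooth_onP => k.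
exact: class_C_comp oA AB (st k) (sh k).
Qed.

(** * Symmetry of second derivatives *)

Lemma is_derive_line V (f : V -> R^o) (y w : V) (s : R) :
  differentiable f (y + s *: w) ->
  is_derive s 1 (fun r : R => f (y + r *: w) : R^o) ('D_w f (y + s *: w)).
Proof.
move=> df; have dl : differentiable (fun r : R => y + r *: w) s.
  by apply: differentiableD => //; exact: differentiable_cst.
have dfl : differentiable (f \o (fun r : R => y + r *: w)) s.
  exact: differentiable_comp.
apply: DeriveDef; first exact: diff_derivable.
rewrite [LHS]derive_comp //; congr ('D_ _ f _).
rewrite deriveD ?derive_cst ?add0r //; last exact: diff_derivable.
by rewrite deriveE // diff_val /= scale1r.
Qed.

Lemma mvt_line V (f : V -> R^o) (y w : V) (t : R) : 0 < t ->
  (forall s, 0 <= s <= t -> differentiable f (y + s *: w)) ->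
  exists2 s, 0 <= s <= t & f (y + t *: w) - f y = t * 'D_w f (y + s *: w).
Proof.
move=> t0 df.
have [||s sI E] := @MVT_segment R (fun r : R => f (y + r *: w))
  (fun s => 'D_w f (y + s *: w)) 0 t (ltW t0).
- by move=> s /[!in_itv]/= /andP[s0 st]; apply/is_derive_line/df; rewrite !ltW.
- apply: derivable_within_continuous => s /[!in_itv]/= sI.
  have := is_derive_line (df s sI); case=> + _; exact.
by exists s => //; rewrite scale0r addr0 in E; rewrite E subr0 mulrC.
Qed.

(** Two applications of the mean value theorem: first along u to the increment
    y |-> f(y + t v) - f(y), then along v to the derivative of f along u.  The
    left-hand side is symmetric in u and v, which is what makes the mixed
    derivatives agree in the limit. *)
Lemma second_difference V (f : V -> R^o) (x u v : V) (t : R) : 0 < t ->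
  (forall a b, 0 <= a <= t -> 0 <= b <= t ->
     differentiable f (x + a *: u + b *: v) /\
     differentiable (fun y => 'D_u f y : R^o) (x + a *: u + b *: v)) ->
  exists a b, [/\ 0 <= a <= t, 0 <= b <= t &
    f (x + t *: u + t *: v) - f (x + t *: u) - f (x + t *: v) + f x =
    t * (t * 'D_v (fun y => 'D_u f y : R^o) (x + a *: u + b *: v))].
Proof.
move=> t0 df; have tI : 0 <= t <= t by rewrite lexx ltW.
have zI : 0 <= (0 : R) <= t by rewrite lexx ltW.
have df1 a : 0 <= a <= t -> differentiable f (x + a *: u).
  by move=> aI; have [] := df a 0 aI zI; rewrite scale0r addr0.
have df2 a : 0 <= a <= t -> differentiable f (x + t *: v + a *: u).
  by move=> aI; have [] := df a t aI tI; rewrite addrAC.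
have dsh a : differentiable (fun y : V => y + t *: v) (x + a *: u).
  by apply: differentiableD => //; exact: differentiable_cst.
have df3 a : 0 <= a <= t -> differentiable (f \o (fun y => y + t *: v)) (x + a *: u).
  by move=> aI; apply: differentiable_comp => //; rewrite addrAC; exact: df2.
pose F y := f (y + t *: v) - f y.
have dF a : 0 <= a <= t -> differentiable (F : V -> R^o) (x + a *: u).
  by move=> aI; apply: differentiableB; [exact: df3|exact: df1].
have [a aI E] := mvt_line t0 dF.
have DF : 'D_u (F : V -> R^o) (x + a *: u) = 'D_u f (x + a *: u + t *: v) - 'D_u f (x + a *: u).
  rewrite (deriveB (diff_derivable (df3 a aI)) (diff_derivable (df1 a aI))).
  rewrite derive_comp //; last by rewrite addrAC; exact: df2.
  congr ('D_ _ f _ - _).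
  by rewrite deriveD ?derive_id ?derive_cst ?addr0 //; exact: diff_derivable.
have [b bI E2] := @mvt_line _ (fun y => 'D_u f y) (x + a *: u) v t t0 (fun b bI => (df a b aI bI).2).
exists a, b; split => //.
rewrite -E2 -DF -E /F opprB addrA [in RHS]addrAC; congr (_ + _).
Qed.

Lemma near_parallelogram V (x u v : V) (P : V -> Prop) :
  (\forall y \near x, P y) ->
  exists2 t : R, 0 < t & forall a b, 0 <= a <= t -> 0 <= b <= t -> P (x + a *: u + b *: v).
Proof.
move=> /nbhs_normP[e e0 He].
pose d := `|u| + `|v| + 1; have d0 : 0 < d by rewrite ltr_wpDl // addr_ge0.
exists (e / d); first exact: divr_gt0.
move=> a b /andP[a0 ad] /andP[b0 bd]; apply: He => /=.
rewrite /ball_/= -addrA opprD addNKr normrN.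
apply: (le_lt_trans (ler_normD _ _)); rewrite !normrZ !ger0_norm //.
apply: (@le_lt_trans _ _ (e / d * (`|u| + `|v|))).
  by rewrite mulrDr lerD // ler_wpM2r.
rewrite -[ltRHS](divfK (lt0r_neq0 d0)) ltr_pM2l ?divr_gt0 //.
by rewrite ltrDl.
Qed.

(** The second difference of f over a small parallelogram equals t^2 times either
    mixed derivative at some point of the parallelogram; continuity of both
    mixed derivatives at x then makes them e-close for every e > 0. *)
Lemma derive_derive_comm V (f : V -> R^o) (A : set V) x u v :
  open A -> A x -> smooth_on A f ->
  'D_u (fun y => 'D_v f y : R^o) x = 'D_v (fun y => 'D_u f y : R^o) x.
Proof.
move=> oA Ax sf.
pose p y := 'D_u (fun y => 'D_v f y : R^o) y; pose q y := 'D_v (fun y => 'D_u f y : R^o) y.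
have su w := smooth_on_derive w sf.
have cp : {for x, continuous (p : V -> R^o)}.
  by apply/differentiable_continuous/(smooth_on_diff _ Ax)/smooth_on_derive.
have cq : {for x, continuous (q : V -> R^o)}.
  by apply/differentiable_continuous/(smooth_on_diff _ Ax)/smooth_on_derive.
rewrite -/(p x) -/(q x); apply/eqP; rewrite -subr_eq0 -normr_le0.
apply/ler_addgt0Pr => e e0; rewrite add0r.
have e2 : 0 < e / 2 by rewrite divr_gt0.
move/cvgrPdist_le: cp => /(_ _ e2) np; move/cvgrPdist_le: cq => /(_ _ e2) nq.
have nA : \forall y \near x, A y by exact: open_nbhs_nbhs.
have [t t0 Ht] := near_parallelogram u v (filterI nA (filterI np nq)).
have [a [b [aI bI E1]]] := @second_difference _ f x u v t t0 (fun a b aI bI =>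
  let HA := (Ht a b aI bI).1 in conj (smooth_on_diff sf HA) (smooth_on_diff (su u) HA)).
have Ht' c d : 0 <= c <= t -> 0 <= d <= t -> A (x + c *: v + d *: u).
  by move=> cI dI; rewrite addrAC; exact: (Ht d c dI cI).1.
have [c [d [cI dI E2]]] := @second_difference _ f x v u t t0 (fun a b aI bI =>
  let HA := Ht' a b aI bI in conj (smooth_on_diff sf HA) (smooth_on_diff (su v) HA)).
have pq : q (x + a *: u + b *: v) = p (x + c *: v + d *: u).
  apply: (mulfI (lt0r_neq0 t0)); apply: (mulfI (lt0r_neq0 t0)).
  apply: etrans (esym E1) _; apply: etrans E2.
  have -> : x + t *: v + t *: u = x + t *: u + t *: v by rewrite addrAC.
  have swap (a1 b1 c1 d1 : R) : a1 - b1 - c1 + d1 = a1 - c1 - b1 + d1 by rewrite [a1 - b1 - _]addrAC.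
  exact: swap.
rewrite -(subrK (p (x + c *: v + d *: u)) (p x)) -addrA (splitr e).
apply: (le_trans (ler_normD _ _)); apply: lerD.
  by rewrite addrAC; exact: (Ht d c dI cI).2.1.
by rewrite -pq distrC; exact: (Ht a b aI bI).2.2.
Qed.

End Smooth.

(** * Smooth functions in charts *)

Section Manifold.
Variables (R : realType) (m : nat) (M : manifold R m).
Implicit Types (c d : chart R m M) (U V : set M) (f g : M -> R) (X Y : field M).

Lemma chart_at_atlas (p : M) : atlas (chart_at p).
Proof. exact: (s2valP (cid2 (atlas_cover p))). Qed.

Lemma chart_at_dom (p : M) : cdom (chart_at p) p.
Proof. exact: (s2valP' (cid2 (atlas_cover p))). Qed.

(** Inside the open image of the chart, this set is the preimage of an open set
    under the continuous inverse of the chart. *)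
Lemma chart_img_open c U : open U -> open (cmap c @` (U `&` cdom c)).
Proof.
move=> oU; rewrite openE => _ [q [Uq cq] <-].
have imq : (cmap c @` cdom c) (cmap c q) by exists q.
have oV : open (U `&` cdom c) by apply: openI => //; exact: cdom_open.
have nV : nbhs (cinv c (cmap c q)) (U `&` cdom c).
  by rewrite cmapK //; apply: open_nbhs_nbhs.
have cc := (@subspace_continuousP _ (cmap c @` cdom c) _ (cinv c)).1 (@cinv_cts _ _ _ c) _ imq.
have H : \forall y \near cmap c q, (cmap c @` cdom c) y -> (U `&` cdom c) (cinv c y).
  exact: cc _ nV.
have nI : nbhs (cmap c q) (cmap c @` cdom c).
  by apply: open_nbhs_nbhs; split=> //; exact: cimg_open.
apply: filterS2 H nI => y Hy Iy; have := Hy Iy; case: Iy => r cr <-.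
by rewrite /= cmapK // => ?; exists r.
Qed.

Lemma cinv_img c U y : (cmap c @` (U `&` cdom c)) y ->
  [/\ U (cinv c y), cdom c (cinv c y) & cmap c (cinv c y) = y].
Proof. by case=> q [Uq cq] <-; rewrite cmapK. Qed.

Lemma smooth_fun_diff c U f q : atlas c -> smooth_fun U f -> U q -> cdom c q ->
  differentiable ((f \o cinv c) : 'rV[R]_m -> R^o) (cmap c q).
Proof. by move=> ac sf Uq cq; apply: (smooth_on_diff (sf c ac)); exists q. Qed.

Lemma transition_diff c d q : atlas c -> atlas d -> cdom c q -> cdom d q ->
  differentiable (cmap d \o cinv c) (cmap c q).
Proof. by move=> ac ad cq dq; apply: (smooth_on_diff (atlas_compat ac ad)); exists q. Qed.

Lemma smooth_fun_sub U V f : V `<=` U -> smooth_fun U f -> smooth_fun V f.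
Proof.
move=> VU sf c ac; apply: smooth_on_sub (sf c ac).
by move=> _ [q [Vq cq] <-]; exists q => //; split=> //; exact: VU.
Qed.

Lemma smooth_field_sub U V X : V `<=` U -> smooth_field U X -> smooth_field V X.
Proof. by move=> VU sX W f oW WV; apply: sX => //; exact: subset_trans VU. Qed.

Lemma smooth_fun_eq U f g : open U -> (forall q, U q -> f q = g q) ->
  smooth_fun U f -> smooth_fun U g.
Proof.
move=> oU fg sf c ac; apply: smooth_on_eq (sf c ac); first exact: chart_img_open.
by move=> y /cinv_img[Uy _ _] /=; exact: fg.
Qed.

Lemma smooth_funD U f g : open U -> smooth_fun U f -> smooth_fun U g ->
  smooth_fun U (fun q => f q + g q).
Proof.
move=> oU sf sg c ac.
exact: (smooth_onD (W := R^o) (chart_img_open oU) (sf c ac) (sg c ac)).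
Qed.

Lemma smooth_fun_cst U (a : R) : smooth_fun U (fun=> a).
Proof. by move=> c ac; exact: (@smooth_on_cst R _ _ _ (a : R^o)). Qed.

Lemma smooth_funM U f g : open U -> smooth_fun U f -> smooth_fun U g ->
  smooth_fun U (fun q => f q * g q).
Proof.
move=> oU sf sg c ac.
exact: (smooth_onM (chart_img_open oU) (sf c ac) (sg c ac)).
Qed.

Lemma smooth_funB U f g : open U -> smooth_fun U f -> smooth_fun U g ->
  smooth_fun U (fun q => f q - g q).
Proof.
move=> oU sf sg; apply: (@smooth_fun_eq _ (fun q => f q + (-1) * g q)) => //.
  by move=> q _; rewrite mulN1r.
by apply: smooth_funD => //; apply: smooth_funM => //; exact: smooth_fun_cst.
Qed.

Lemma smooth_fun_sum U (I : Type) (r : seq I) (F : I -> M -> R) : open U ->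
  (forall i, smooth_fun U (F i)) -> smooth_fun U (fun q => \sum_(i <- r) F i q).
Proof.
move=> oU sF; elim: r => [|i r IH].
  apply: (@smooth_fun_eq _ (fun=> 0)) => //; last exact: smooth_fun_cst.
  by move=> q _; rewrite big_nil.
apply: (@smooth_fun_eq _ (fun q => F i q + \sum_(j <- r) F j q)) => //.
  by move=> q _; rewrite big_cons.
exact: smooth_funD.
Qed.

Lemma coord_smooth c k : atlas c -> smooth_fun (cdom c) (fun q => cmap c q 0 k).
Proof.
move=> ac d ad; have := atlas_compat ad ac; rewrite setIC => st.
by apply: smooth_on_coord st; apply: chart_img_open; exact: cdom_open.
Qed.

(** * Tangent vectors as derivations *)

(** The chain rule for a change of charts.  It gives both the transformation rule
    of tangent vectors and the comparison of the chart chosen at q with a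
    neighbouring chart. *)
Lemma dir_deriv_chart c d U f q w : atlas c -> atlas d -> open U ->
  smooth_fun U f -> U q -> cdom c q -> cdom d q ->
  'D_w ((f \o cinv d) : 'rV[R]_m -> R^o) (cmap d q) =
  'D_('D_w (cmap c \o cinv d) (cmap d q)) ((f \o cinv c) : 'rV[R]_m -> R^o) (cmap c q).
Proof.
move=> ac ad oU sf Uq cq dq.
have E : cmap c q = (cmap c \o cinv d) (cmap d q) by rewrite /= cmapK.
rewrite [in RHS]E -derive_comp; last 2 first.
- exact: transition_diff.
- by rewrite -E; exact: smooth_fun_diff sf Uq cq.
apply: near_eq_derive.
apply: (open_near_eq (A := cmap d @` ((U `&` cdom c) `&` cdom d))).
- by apply: chart_img_open; apply: openI => //; exact: cdom_open.
- by exists q.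
- by move=> y /cinv_img[[Uy cy] dy _] /=; rewrite cmapK.
Qed.

Lemma dir_deriv_eq U f g q w : open U -> U q -> (forall r, U r -> f r = g r) ->
  dir_deriv f q w = dir_deriv g q w.
Proof.
move=> oU Uq fg; apply: near_eq_derive.
apply: (open_near_eq (A := cmap (chart_at q) @` (U `&` cdom (chart_at q)))).
- exact: chart_img_open.
- by exists q => //; split=> //; exact: chart_at_dom.
- by move=> y /cinv_img[Uy _ _] /=; exact: fg.
Qed.

Lemma act_eq U f g X q : open U -> U q -> (forall r, U r -> f r = g r) ->
  act X f q = act X g q.
Proof. exact: dir_deriv_eq. Qed.

Lemma derivable_at U f q w : smooth_fun U f -> U q ->
  derivable ((f \o cinv (chart_at q)) : 'rV[R]_m -> R^o) (cmap (chart_at q) q) w.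
Proof.
move=> sf Uq; apply: diff_derivable.
exact: smooth_fun_diff (chart_at_atlas q) sf Uq (chart_at_dom q).
Qed.

Lemma actD U f g X q : smooth_fun U f -> smooth_fun U g -> U q ->
  act X (fun r => f r + g r) q = act X f q + act X g q.
Proof.
by move=> sf sg Uq; exact: (deriveD (derivable_at sf Uq) (derivable_at sg Uq)).
Qed.

Lemma actM U f g X q : smooth_fun U f -> smooth_fun U g -> U q ->
  act X (fun r => f r * g r) q = act X f q * g q + f q * act X g q.
Proof.
move=> sf sg Uq.
have := deriveM (derivable_at sf Uq) (derivable_at sg Uq).
rewrite /act /dir_deriv => ->; rewrite addrC [_ *: _]mulrC /= cmapK //.
exact: chart_at_dom.
Qed.

Lemma act_cst (a : R) X q : act X (fun=> a) q = 0.
Proof. exact: derive_cst. Qed.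

Lemma act_sum U (I : Type) (r : seq I) (F : I -> M -> R) X q : open U ->
  (forall i, smooth_fun U (F i)) -> U q ->
  act X (fun q => \sum_(i <- r) F i q) q = \sum_(i <- r) act X (F i) q.
Proof.
move=> oU sF Uq; elim: r => [|i r IH].
  by rewrite big_nil -[RHS](act_cst 0 X q); apply: (act_eq _ oU Uq) => s _; rewrite big_nil.
rewrite big_cons -IH -(actD _ (sF i) (smooth_fun_sum r oU sF) Uq).
by apply: (act_eq _ oU Uq) => s _; rewrite big_cons.
Qed.

(** * Coordinate fields *)

Lemma extend_at (p : M) v : extend p v p = v.
Proof.
rewrite /extend (@near_eq_derive _ _ _ _ id) ?derive_id //.
apply: (open_near_eq (A := cmap (chart_at p) @` (setT `&` cdom (chart_at p)))).
- by apply: chart_img_open; exact: openT.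
- by exists p => //; split=> //; exact: chart_at_dom.
- by move=> y /cinv_img[_ _] /=.
Qed.

(** Although the components of [extend p v] at q refer to the chart chosen at q,
    its action is differentiation in the fixed chart at p. *)
Lemma act_extend (p : M) v U f q : open U -> smooth_fun U f -> U q ->
  cdom (chart_at p) q ->
  act (extend p v) f q =
  'D_v ((f \o cinv (chart_at p)) : 'rV[R]_m -> R^o) (cmap (chart_at p) q).
Proof.
move=> oU sf Uq pq; rewrite [RHS](dir_deriv_chart (c := chart_at q) v _ _ oU sf) //;
  solve [exact: chart_at_atlas | exact: chart_at_dom].
Qed.

(** Read in a chart c, the function [act (extend p v) f] is a directional
    derivative in the chart at p precomposed with the transition map from c. *)
Lemma extend_smooth (p : M) v : smooth_field (cdom (chart_at p)) (extend p v).
Proof.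
move=> V f oV Vp sf c ac; set cp := chart_at p.
have acp : atlas cp by exact: chart_at_atlas.
apply: (@smooth_on_eq _ _ _ _
  ((fun y => 'D_v ((f \o cinv cp) : 'rV[R]_m -> R^o) y) \o (cmap cp \o cinv c))).
- exact: chart_img_open.
- by move=> y /cinv_img[Vy _ _] /=; rewrite (act_extend _ oV sf) //; exact: Vp.
apply: (@smooth_on_comp _ _ _ _ (cmap cp @` (V `&` cdom cp))).
- exact: chart_img_open.
- move=> y /cinv_img[Vy cy _] /=; exists (cinv c y) => //.
  by split=> //; exact: Vp.
- apply: smooth_on_sub (atlas_compat ac acp).
  by move=> _ [q [Vq cq] <-]; exists q => //; split=> //; exact: Vp.
- by apply: smooth_on_derive; exact: sf.
Qed.

(** The chain rule through the chart at p, where the components of w are the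
    derivatives of the coordinate functions along w. *)
Lemma dir_deriv_coord (p : M) U f q w : open U -> smooth_fun U f -> U q ->
  cdom (chart_at p) q ->
  dir_deriv f q w = \sum_k dir_deriv (fun r => cmap (chart_at p) r 0 k) q w *
                           act (extend p (delta_mx 0 k)) f q.
Proof.
move=> oU sf Uq pq.
have aq := chart_at_atlas q; have ap := chart_at_atlas p; have qq := chart_at_dom q.
rewrite {1}/dir_deriv (dir_deriv_chart (c := chart_at p) w ap aq oU sf) //.
rewrite derive_coord_sum; last exact: smooth_fun_diff sf Uq pq.
apply: eq_bigr => k _; rewrite (act_extend _ oU sf) //; congr (_ * _).
by rewrite -derive_mx_coord //; exact: transition_diff.
Qed.

Lemma dir_deriv_delta (p : M) U f w : open U -> smooth_fun U f -> U p ->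
  dir_deriv f p w = \sum_k w 0 k * act (extend p (delta_mx 0 k)) f p.
Proof.
move=> oU sf Up; rewrite /dir_deriv derive_coord_sum; last first.
  exact: smooth_fun_diff (chart_at_atlas p) sf Up (chart_at_dom p).
by apply: eq_bigr => k _; rewrite /act extend_at.
Qed.

(** Coordinate fields commute: in the chart at p this is the symmetry of second
    derivatives. *)
Lemma act_extend_comm (p : M) u v U f : open U -> smooth_fun U f -> U p ->
  act (extend p u) (act (extend p v) f) p = act (extend p v) (act (extend p u) f) p.
Proof.
move=> oU sf Up; set c := chart_at p.
have cp : cdom c p by exact: chart_at_dom.
have ac : atlas c by exact: chart_at_atlas.
have oI : open (U `&` cdom c) by apply: openI => //; exact: cdom_open.
have E w z : act (extend p w) (act (extend p z) f) p =
    'D_w (fun y => 'D_z ((f \o cinv c) : 'rV[R]_m -> R^o) y : R^o) (cmap c p).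
  rewrite {1}/act extend_at; apply: near_eq_derive.
  apply: (open_near_eq (A := cmap c @` (U `&` cdom c))).
  - exact: chart_img_open.
  - by exists p.
  - move=> y /cinv_img[Uy cy yE] /=; rewrite (act_extend _ oU sf) //.
    by rewrite yE.
rewrite !E; apply: (derive_derive_comm (A := cmap c @` (U `&` cdom c))).
- exact: chart_img_open.
- by exists p.
- exact: sf.
Qed.

(** Expanding Y f = sum_k Y(x^k) d_k f and applying X, the second-order terms
    sum_kl Y(x^k) X(x^l) d_l d_k f are symmetric in X and Y and cancel in the
    commutator; what remains are the components of the bracket. *)
Lemma act_lie U X Y f p : open U -> smooth_field U X -> smooth_field U Y ->
  smooth_fun U f -> U p ->
  act (lie X Y) f p = act X (act Y f) p - act Y (act X f) p.
Proof.
move=> oU sX sY sf Up; set c := chart_at p.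
have cp : cdom c p by exact: chart_at_dom.
have ac : atlas c by exact: chart_at_atlas.
pose W := U `&` cdom c.
have oW : open W by apply: openI => //; exact: cdom_open.
have Wp : W p by [].
have WU : W `<=` U by move=> ? [].
have Wc : W `<=` cdom c by move=> ? [].
have sfW : smooth_fun W f := smooth_fun_sub WU sf.
pose x k (q : M) := cmap c q 0 k.
have sx k : smooth_fun W (x k) := smooth_fun_sub Wc (coord_smooth k ac).
pose dk k := act (extend p (delta_mx 0 k)) f.
have sd k : smooth_fun W (dk k) by apply: (@extend_smooth p _ W f oW Wc sfW).
have local Z q : W q -> act Z f q = \sum_k act Z (x k) q * dk k q.
  by move=> [Uq cq]; exact: (dir_deriv_coord (p := p)) oU sf Uq cq.
(* First- and second-order parts of Z1 (Z2 f) at p. *)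
have twice Z1 Z2 : smooth_field U Z2 ->
    act Z1 (act Z2 f) p =
    \sum_k (act Z1 (act Z2 (x k)) p * dk k p) +
    \sum_k \sum_l (act Z2 (x k) p * act Z1 (x l) p) *
      act (extend p (delta_mx 0 l)) (dk k) p.
  move=> s2; have sa k : smooth_fun W (act Z2 (x k)) by exact: s2.
  rewrite (act_eq _ oW Wp (local Z2)) (act_sum _ _ oW _ Wp); last first.
    by move=> k; exact: smooth_funM.
  rewrite -big_split /=; apply: eq_bigr => k _.
  rewrite (actM _ (sa k) (sd k) Wp); congr (_ + _).
  rewrite {2}/act (dir_deriv_coord (p := p) _ oW (sd k) Wp cp) mulr_sumr.
  by apply: eq_bigr => l _; rewrite mulrA.
rewrite {1}/act (dir_deriv_delta _ oW sfW Wp) (twice X Y) // (twice Y X) //.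
rewrite opprD addrACA -sumrB [X in _ = _ + X](_ : _ = 0) ?addr0.
  by apply: eq_bigr => k _; rewrite mxE mulrBl.
rewrite [X in _ - X]exchange_big -sumrB big1 // => k _; rewrite -sumrB big1 // => l _.
by rewrite [X in _ - _ * X](act_extend_comm _ _ oW sfW Wp) [X in _ - X * _]mulrC subrr.
Qed.

Lemma lie_smooth U X Y : open U -> smooth_field U X -> smooth_field U Y ->
  smooth_field U (lie X Y).
Proof.
move=> oU sX sY V f oV VU sf.
have sXV := smooth_field_sub VU sX; have sYV := smooth_field_sub VU sY.
apply: (@smooth_fun_eq _ (fun q => act X (act Y f) q - act Y (act X f) q)) => //.
  by move=> q Vq; rewrite (act_lie oV sXV sYV sf Vq).
apply: smooth_funB => //.
  by apply: sXV => //; apply: sYV.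
by apply: sYV => //; apply: sXV.
Qed.

End Manifold.

(** * Nondegenerate bilinear forms *)

(* Otherwise [form] would denote the sesquilinear form of a matrix. *)
Local Notation form := Defs.form.

Section Form.
Variables (R : realType) (m : nat) (M : manifold R m) (g : M -> 'M[R]_m).
Implicit Types (p : M) (u v w : 'rV[R]_m) (a : R).

Lemma formBl p u v w : form g p (u - v) w = form g p u w - form g p v w.
Proof. by rewrite /form !mulmxBl !mxE. Qed.

Lemma formZl p a v w : form g p (a *: v) w = a * form g p v w.
Proof. by rewrite /form -!scalemxAl mxE. Qed.

Lemma formBr p u v w : form g p u (v - w) = form g p u v - form g p u w.
Proof. by rewrite /form linearB /= mulmxBr !mxE. Qed.

Lemma formZr p a v w : form g p v (a *: w) = a * form g p v w.
Proof. by rewrite /form linearZ /= -scalemxAr mxE. Qed.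

(** A dual vector is read off from a nonzero component of v, since u g v^T is the
    k-th component of v when u is the k-th row of the inverse of g. *)
Lemma form_dual p v : g p \in unitmx -> v != 0 -> exists u, form g p u v = 1.
Proof.
move=> gu v0; have [k vk] : exists k, v 0 k != 0.
  apply: contra_notP (negP v0) => nv; apply/eqP/rowP => k; rewrite mxE.
  by apply/eqP; apply: contra_notT nv => vk; exists k.
exists ((v 0 k)^-1 *: (delta_mx 0 k *m invmx (g p))).
rewrite formZl /form mulmxKV //.
by rewrite -rowE !mxE mulVf.
Qed.

End Form.

(** Two standard basis vectors cannot both be multiples of v. *)
Lemma not_collinear (F : fieldType) m (v : 'rV[F]_m) : (1 < m)%N ->
  exists w : 'rV[F]_m, forall k, w <> k *: v.
Proof.
case: m v => [|[|m]] // v _.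
pose e i : 'rV[F]_m.+2 := delta_mx 0 i.
have [[k Ek]|H] := pselect (exists k, e 0 = k *: v); last by exists (e 0) => k ?; apply: H; exists k.
exists (e 1) => l El.
move: (congr1 (fun r : 'rV_m.+2 => r 0 0) Ek) (congr1 (fun r : 'rV_m.+2 => r 0 1) Ek) (congr1 (fun r : 'rV_m.+2 => r 0 1) El).
rewrite !mxE /= => k0 /esym/eqP; rewrite mulf_eq0 => /orP[/eqP kE|/eqP vE].
  by rewrite kE mul0r in k0; have /eqP := k0; rewrite oner_eq0.
by rewrite vE mulr0 => /eqP; rewrite oner_eq0.
Qed.

(** * Skew curvature tensors of constant-curvature shape *)

Section SkewCurvature.
Variables (F : numFieldType) (V : lmodType F) (b : V -> V -> F).
Hypothesis b_sym : forall u v, b u v = b v u.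
Hypothesis b_lin : forall u k v w, b u (v - k *: w) = b u v - k * b u w.
Hypothesis b_dual : forall v, v != 0 -> exists u, b u v = 1.
Hypothesis V_dim : forall v : V, exists w : V, forall k, w <> k *: v.
(* T stands for fields and ev for evaluation at a point; B is not assumed to
   factor through ev, nor to be additive. *)
Variables (T : Type) (D : T -> Prop) (ev : T -> V) (B : T -> T -> F).
Hypothesis ev_surj : forall v, exists2 X, D X & ev X = v.
Hypothesis skew : forall X Y Z W, D X -> D Y -> D Z -> D W ->
  B Y Z * b (ev X) (ev W) - B X Z * b (ev Y) (ev W) +
  (B Y W * b (ev X) (ev Z) - B X W * b (ev Y) (ev Z)) = 0.

Let b0 u : b u 0 = 0.
Proof. by have := b_lin u 1 0 0; rewrite scale1r subr0 mul1r subrr. Qed.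

Let proportional (Z : T) (c : F) := forall Y, D Y -> B Y Z = c * b (ev Y) (ev Z).

(** If Z vanishes at the point, the identity says that B(Y, Z) x - B(X, Z) y is
    orthogonal to every vector, where x and y are the values of X and Y; with x
    not collinear to y this forces B(Y, Z) = 0. *)
Let proportional0 (Z : T) c : D Z -> ev Z = 0 -> proportional Z c.
Proof.
move=> DZ Z0 Y DY; rewrite Z0 b0 mulr0; apply/eqP; apply: contraT => BYZ.
have [x xY] := V_dim (ev Y); have [X DX Xx] := ev_surj x.
have /eqP : x <> (B X Z / B Y Z) *: ev Y by exact: xY.
rewrite -subr_eq0 => /b_dual[w bw]; have [W DW Ww] := ev_surj w.
have := skew DX DY DZ DW; rewrite Z0 !b0 !mulr0 subr0 addr0 Xx Ww.
move: bw; rewrite b_lin [b w x]b_sym [b w _]b_sym => bw.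
move=> /(congr1 ( *%R (B Y Z)^-1)); rewrite mulr0 mulrBr mulKf // mulrA [_^-1 * _]mulrC bw.
by move/eqP; rewrite oner_eq0.
Qed.

(** The identity with W = Z and g(X, Z) = 1. *)
Let proportional_ex (Z : T) : D Z -> exists c, proportional Z c.
Proof.
move=> DZ; have [Z0|/b_dual[x bx]] := eqVneq (ev Z) 0.
  by exists 0; exact: proportional0.
have [X DX Xx] := ev_surj x; exists (B X Z) => Y DY.
have /eqP := skew DX DY DZ DZ.
by rewrite -mulr2n mulrn_eq0 /= subr_eq0 Xx bx mulr1 => /eqP.
Qed.

(** Substituting the two proportionalities in the identity leaves
      (c - d) (g(Y, Z) g(X, W) - g(X, Z) g(Y, W)) = 0,
    and X, Y can be chosen so that the second factor is 1. *)
Let proportional_eq (Z W : T) c d : D Z -> D W -> ev Z != 0 ->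
  (forall k, ev W <> k *: ev Z) -> proportional Z c -> proportional W d -> c = d.
Proof.
move=> DZ DW Z0 WZ cZ dW.
have [y by1] := b_dual Z0; have [Y DY Yy] := ev_surj y.
have /eqP := WZ (b y (ev W)); rewrite -subr_eq0 => /b_dual[x].
rewrite b_lin => bx; have [X DX Xx] := ev_surj x.
have := skew DX DY DZ DW.
rewrite (cZ Y) // (cZ X) // (dW Y) // (dW X) // Yy Xx by1 !mulr1 => E.
apply/eqP; rewrite -subr_eq0 -[c - d]mulr1 -bx -E; apply/eqP.
ring.
Qed.

(** All factors are compared with those of two non-collinear vectors z0 and w0: a
    vector that is not a multiple of z0 is compared with z0, and a nonzero
    multiple of z0 with w0. *)
Lemma skew_curvature_scalar :
  exists c, forall Y Z, D Y -> D Z -> B Y Z = c * b (ev Y) (ev Z).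
Proof.
have [z0 z0P] := V_dim 0; have [w0 w0P] := V_dim z0.
have z00 : z0 != 0 by apply/eqP => E; apply: (z0P 0); rewrite scaler0.
have [Z DZ Zz] := ev_surj z0; have [W DW Ww] := ev_surj w0.
have [c cZ] := proportional_ex DZ; have [d dW] := proportional_ex DW.
have cd : c = d by apply: proportional_eq cZ dW => //; rewrite Zz // Ww.
exists c => Y X DY DX; suff : proportional X c by exact.
have [X0|X0] := eqVneq (ev X) 0; first exact: proportional0.
have [a aX] := proportional_ex DX.
have [[k Xk]|Xz] := pselect (exists k, ev X = k *: z0); last first.
  suff -> : c = a by [].
  apply: proportional_eq cZ aX => //; rewrite Zz // => k E.
  by apply: Xz; exists k.
rewrite cd; suff <- : a = d by [].
by apply: proportional_eq aX dW => // l; rewrite Ww Xk scalerA; exact: w0P.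
Qed.

End SkewCurvature.

(** * Curvature and the Einstein condition *)

Section Curvature.
Variables (R : realType) (m : nat) (M : manifold R m).

(** Differentiating g(Z, W) along Y and then X by compatibility produces the terms
    g(D_Y Z, D_X W) + g(D_X Z, D_Y W), symmetric in X and Y; they disappear in
    the commutator, which is the derivative along [X, Y]. *)
Lemma Rm_skew (g : M -> 'M[R]_m) (nabla : field M -> field M -> field M)
    (U : set M) (X Y Z W : field M) p :
  pseudo_metric g -> affine_connection nabla -> metric_compatible g nabla ->
  open U -> U p -> smooth_field U X -> smooth_field U Y ->
  smooth_field U Z -> smooth_field U W ->
  form g p (Rm nabla X Y Z p) (W p) + form g p (Z p) (Rm nabla X Y W p) = 0.
Proof.
move=> [gsym _ gsm] aff comp oU Up sX sY sZ sW.
have sn A C : smooth_field U A -> smooth_field U C -> smooth_field U (nabla A C).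
  exact: nabla_smooth aff _ _ _ oU.
pose b (A C : field M) q := form g q (A q) (C q).
have sb A C : smooth_field U A -> smooth_field U C -> smooth_fun U (b A C).
  exact: gsm.
have D A C E q : smooth_field U A -> smooth_field U C -> smooth_field U E -> U q ->
    act A (b C E) q = b (nabla A C) E q + b C (nabla A E) q.
  by move=> sA sC sE Uq; exact: comp oU Uq sA sC sE.
have DD A C : smooth_field U A -> smooth_field U C ->
    act A (act C (b Z W)) p =
    b (nabla A (nabla C Z)) W p + b (nabla C Z) (nabla A W) p +
    (b (nabla A Z) (nabla C W) p + b Z (nabla A (nabla C W)) p).
  move=> sA sC; have sCZ := sn C Z sC sZ; have sCW := sn C W sC sW.
  have DC q : U q -> act C (b Z W) q = b (nabla C Z) W q + b Z (nabla C W) q.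
    exact: D.
  apply: etrans (act_eq A oU Up DC) _.
  apply: etrans (actD A (sb _ _ sCZ sW) (sb _ _ sZ sCW) Up) _.
  by congr (_ + _); apply: D.
have := act_lie oU sX sY (sb Z W sZ sW) Up.
rewrite (D _ _ _ _ (lie_smooth oU sX sY) sZ sW Up).
rewrite (DD X Y sX sY) (DD Y X sY sX).
rewrite /b /Rm !formBl !formBr => /esym/eqP; rewrite -subr_eq0 => /eqP E.
by rewrite -[RHS]E; ring.
Qed.
End Curvature.

(** The factor is found pointwise, from all fields that are smooth near p at once,
    so that it does not depend on the open set on which they are given. *)
Lemma projectively_flat_einstein (R : realType) (n : nat) (M : manifold R n.*2.+1)
    (g : M -> 'M[R]_(n.*2.+1)) (nabla : field M -> field M -> field M) :
  (0 < n)%N -> pseudo_metric g -> levi_civita g nabla ->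
  weyl_projectively_flat nabla -> einstein g nabla.
Proof.
move=> n0 gP [aff _ comp] flat; have [gsym gunit _] := gP.
suff /choice[lam lamP] p : exists l, forall X Y,
    (exists U, [/\ open U, U p & smooth_field U X]) ->
    (exists U, [/\ open U, U p & smooth_field U Y]) ->
    Ric nabla X Y p = l * form g p (X p) (Y p).
  by exists lam => U X Y p oU Up sX sY; apply: lamP; exists U.
pose D (X : field M) := exists U, [/\ open U, U p & smooth_field U X].
apply: (@skew_curvature_scalar _ _ (form g p) (gsym p) _ _ _ _ D
  (fun X => X p) (fun X Y => Ric nabla X Y p)).
- by move=> u k v w; rewrite formBr formZr.
- by move=> v; exact: form_dual.
- by move=> v; apply: not_collinear; rewrite ltnS double_gt0.
- move=> v; exists (extend p v); last exact: extend_at.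
  exists (cdom (chart_at p)); split; [exact: cdom_open|exact: chart_at_dom|].
  exact: extend_smooth.
move=> X Y Z W [U1 [oU1 U1p sX]] [U2 [oU2 U2p sY]] [U3 [oU3 U3p sZ]] [U4 [oU4 U4p sW]].
pose U := (U1 `&` U2) `&` (U3 `&` U4).
have oU : open U by do 2!apply: openI => //; exact: openI.
have Up : U p by [].
have {}sX : smooth_field U X by apply: smooth_field_sub sX => ? [[]].
have {}sY : smooth_field U Y by apply: smooth_field_sub sY => ? [[]].
have {}sZ : smooth_field U Z by apply: smooth_field_sub sZ => ? [_ []].
have {}sW : smooth_field U W by apply: smooth_field_sub sW => ? [_ []].
have RmE A : smooth_field U A ->
    Rm nabla X Y A p = (n.*2%:R)^-1 *: (Ric nabla Y A p *: X p - Ric nabla X A p *: Y p).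
  by move=> sA; apply/eqP; rewrite -subr_eq0; apply/eqP; exact: flat oU Up sX sY sA.
have := Rm_skew gP aff comp oU Up sX sY sZ sW.
rewrite !RmE // formZl formZr formBl formBr !formZl !formZr -mulrDr.
rewrite [form g p (Z p) (X p)]gsym [form g p (Z p) (Y p)]gsym.
move/eqP; rewrite mulf_eq0 invr_eq0 pnatr_eq0 double_eq0.
by case/orP => [|/eqP //]; rewrite eqn0Ngt n0.
Qed.

Unset Implicit Arguments.

Theorem theorem3p6 (R : realType) (n : nat) (n_ge1 : (1 <= n)%N)
    (M : manifold R n.*2.+1) (S : almost_paracontact_metric M)
    (nabla : field M -> field M -> field M)
    (nablaLC : levi_civita (metric S) nabla)
    (alpha beta : M -> R)
    (alpha_smooth : smooth_fun setT alpha)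
    (beta_smooth : smooth_fun setT beta)
    (tps : trans_para_sasakian S nabla alpha beta)
    (grad_cond : forall p : M,
       endo (phi S) p (grad (metric S) alpha p) =
       - (n.*2%:R - 1) *: grad (metric S) beta p)
    (flat : weyl_projectively_flat nabla) :
  einstein (metric S) nabla.
Proof.
exact: projectively_flat_einstein n_ge1 (metric_pseudo S) nablaLC flat.
Qed.
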